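(* (a) Let $M\in\mathcal{LC}$. Then $H^{\infty}_{v_M}(\mathbb{C})$ is not closed under point-wise multiplication. (b) Let $u$ be a normalized weight. Then $H^{\infty}_u(\mathbb{C})$ is not closed under point-wise multiplication.
   Context: $\mathbb{N}=\{0,1,2,\dots\}$. A weight is a continuous, non-increasing function $v:[0,+\infty)\to(0,+\infty)$ with $\lim_{t\to+\infty}t^kv(t)=0$ for all $k\ge0$; it is normalized if $v(t)=1$ for all $t\in[0,1]$. $H(\mathbb{C})$ is the space of entire functions and $H^{\infty}_v(\mathbb{C}):=\{f\in H(\mathbb{C}):\|f\|_v:=\sup_{z\in\mathbb{C}}|f(z)|v(|z|)<+\infty\}$. $\mathcal{LC}$ is the set of sequences $M=(M_j)_{j\in\mathbb{N}}$ of positive reals with $1=M_0\le M_1$, $M_j^2\le M_{j-1}M_{j+1}$ for all $j\ge1$, and $\lim_{j\to+\infty}(M_j)^{1/j}=+\infty$. For $M\in\mathcal{LC}$ put $\omega_M(t):=\sup_{j\in\mathbb{N}}\log(t^j/M_j)$ for $t>0$, $\omega_M(0):=0$, and $v_M(t):=\exp(-\omega_M(t))$. *)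

(* Defs.v *)
From Stdlib Require Import Reals.
From Coquelicot Require Import Coquelicot.

Open Scope R_scope.

(* Functions on [0,+oo) are represented by total functions R -> R; only their
   values at nonnegative arguments matter. *)
Record weight (v : R -> R) : Prop := {
  weight_cont : continuous_on (fun t => 0 <= t) v;
  weight_noninc : forall s t, 0 <= s -> s <= t -> v t <= v s;
  weight_pos : forall t, 0 <= t -> 0 < v t;
  weight_decay : forall k : nat, is_lim (fun t => t ^ k * v t) p_infty 0
}.

Definition normalized (v : R -> R) : Prop :=
  forall t, 0 <= t <= 1 -> v t = 1.

Definition entire (f : C -> C) : Prop :=
  forall z : C, @ex_derive C_AbsRing C_NormedModule f z.

(* The supremum is taken in the extended reals, so it may be p_infty. *)
Definition weighted_norm (v : R -> R) (f : C -> C) : Rbar :=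
  Lub_Rbar (fun x => exists z : C, x = Cmod (f z) * v (Cmod z)).

Definition Hinf (v : R -> R) (f : C -> C) : Prop :=
  entire f /\ Rbar_lt (weighted_norm v f) p_infty.

Definition mult_closed (A : (C -> C) -> Prop) : Prop :=
  forall f g : C -> C, A f -> A g -> A (fun z => Cmult (f z) (g z)).

Record LC (M : nat -> R) : Prop := {
  LC_pos : forall j, 0 < M j;
  LC_0 : M 0%nat = 1;
  LC_01 : M 0%nat <= M 1%nat;
  LC_logconvex :
    forall j, (1 <= j)%nat -> M j ^ 2 <= M (j - 1)%nat * M (j + 1)%nat;
  LC_root : is_lim_seq (fun j => Rpower (M j) (/ INR j)) p_infty
}.

(* For M in LC and t > 0 the supremum is finite: t^j / M_j tends to 0 because
   M_j^(1/j) tends to infinity. Hence [real] loses nothing. *)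
Definition omega (M : nat -> R) (t : R) : R :=
  if Rlt_dec 0 t
  then real (Sup_seq (fun j => Finite (ln (t ^ j / M j))))
  else 0.

Definition weight_of_seq (M : nat -> R) (t : R) : R := exp (- omega M t).

(* Main.v *)
Require Import Defs.
From Stdlib Require Import Reals Lra Lia Classical IndefiniteDescription.
From Coquelicot Require Import Coquelicot.

Local Open Scope R_scope.

(** Let [v] be a positive function on [0 <= t] that decays faster than every
    power, as both kinds of weights in the theorem do. For a natural number [n]
    let [m] be the supremum of [s ^ n * v s]. Then [s ^ n / m <= 1 / v s] for
    all [s], and there is a point [t] at which this inequality is an equality up
    to a factor 2; moreover [t] tends to infinity with [n]
    ([rapid_near_maximum]). So a single monomial touches the largest growth that
    the space permits, at a point where [1 / v] is as large as one likes.

    Choose such triples [(n k, m k, t k)] with [v (t k) <= 16 ^ (- k)] and put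
    [f z = sum_k 2 ^ (- k) * z ^ n k / m k]. All terms have modulus at most
    [2 ^ (- k) / v |z|], so the series converges everywhere, is entire
    ([monomial_series_entire]) and belongs to the space. Its coefficients are
    nonnegative, so [f (t k)] is at least its [k]-th term, that is, at least
    [2 ^ (- k) / (2 * v (t k))]. Consequently
    [f (t k) ^ 2 * v (t k) >= 4 ^ (- k) / (4 * v (t k)) >= 4 ^ k / 4], and [f ^ 2]
    is not in the space ([rapid_not_mult_closed]). Choosing the exponents
    according to the points [t k] is what lets the argument work for every rate
    of decay: for very fast decay, a full series such as
    [sum_j z ^ j / (2 ^ j * m_j)] may have all its powers in the space.

    What remains is that the weights of the theorem have these properties. For
    [weight_of_seq M] the bound [t ^ k * v t <= M k] is the definition of
    [omega] as a supremum, once this supremum is known to be finite. *)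

(** * Absolutely convergent complex series *)

(** Summing coordinatewise reduces everything to real series, at the price of
    a constant 2 in the triangle inequality [Cmod_Csum_le]. *)
Definition Csum (w : nat -> C) : C :=
  (Series (fun k => fst (w k)), Series (fun k => snd (w k))).

Definition abs_summable (w : nat -> C) : Prop :=
  ex_series (fun k => Cmod (w k)).

Lemma abs_summable_le (w : nat -> C) (b : nat -> R) :
  (forall k, Cmod (w k) <= b k) -> ex_series b -> abs_summable w.
Proof.
  intros Hb Eb.
  apply (ex_series_le (V := R_CompleteNormedModule)) with (2 := Eb).
  intros k. change (Rabs (Cmod (w k)) <= b k).
  rewrite Rabs_pos_eq; [apply Hb | apply Cmod_ge_0].
Qed.

Lemma abs_summable_coord (w : nat -> C) :
  abs_summable w ->
  ex_series (fun k => Rabs (fst (w k))) /\ ex_series (fun k => Rabs (snd (w k))).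
Proof.
  intros Hw; split;
    apply (ex_series_le (V := R_CompleteNormedModule)) with (2 := Hw);
    intros k; pose proof (Rmax_Cmod (w k)) as Hk;
    [ change (Rabs (Rabs (fst (w k))) <= Cmod (w k))
    | change (Rabs (Rabs (snd (w k))) <= Cmod (w k)) ];
    rewrite Rabs_Rabsolu; eapply Rle_trans; try exact Hk;
    [ apply Rmax_l | apply Rmax_r ].
Qed.

Lemma ex_series_coord (w : nat -> C) :
  abs_summable w ->
  ex_series (fun k => fst (w k)) /\ ex_series (fun k => snd (w k)).
Proof.
  intros Hw; destruct (abs_summable_coord w Hw) as [H1 H2].
  split; now apply ex_series_Rabs.
Qed.

Lemma Cmod_Csum_le (w : nat -> C) (b : nat -> R) :
  (forall k, Cmod (w k) <= b k) -> ex_series b ->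
  Cmod (Csum w) <= 2 * Series b.
Proof.
  intros Hb Eb.
  destruct (abs_summable_coord w (abs_summable_le w b Hb Eb)) as [H1 H2].
  assert (B1 : Rabs (fst (Csum w)) <= Series b).
  { eapply Rle_trans; [now apply Series_Rabs |].
    apply Series_le; [| exact Eb]. intros k; split; [apply Rabs_pos |].
    eapply Rle_trans; [| apply Hb].
    eapply Rle_trans; [| apply Rmax_Cmod]. apply Rmax_l. }
  assert (B2 : Rabs (snd (Csum w)) <= Series b).
  { eapply Rle_trans; [now apply Series_Rabs |].
    apply Series_le; [| exact Eb]. intros k; split; [apply Rabs_pos |].
    eapply Rle_trans; [| apply Hb].
    eapply Rle_trans; [| apply Rmax_Cmod]. apply Rmax_r. }
  pose proof (Rabs_pos (fst (Csum w))).
  eapply Rle_trans; [apply Cmod_2Rmax |].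
  apply Rmult_le_compat.
  - apply sqrt_pos.
  - eapply Rle_trans; [apply Rabs_pos | apply Rmax_l].
  - rewrite <- (sqrt_square 2) at 2 by lra. apply sqrt_le_1; lra.
  - now apply Rmax_lub.
Qed.

(** Linearity of the sum, in the form in which a difference quotient of a
    series is compared with the series of derivatives. *)
Lemma Csum_remainder (u v w : nat -> C) (h : C) :
  abs_summable u -> abs_summable v -> abs_summable w ->
  Csum (fun k => u k - v k - h * w k)%C = (Csum u - Csum v - h * Csum w)%C.
Proof.
  intros Hu Hv Hw.
  destruct (ex_series_coord u Hu) as [Hu1 Hu2].
  destruct (ex_series_coord v Hv) as [Hv1 Hv2].
  destruct (ex_series_coord w Hw) as [Hw1 Hw2].
  assert (S : forall c x, ex_series x -> ex_series (fun k : nat => c * x k)).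
  { intros c x Hx. now apply (ex_series_scal c x). }
  assert (P : forall x y, ex_series x -> ex_series y ->
                ex_series (fun k : nat => x k + y k)).
  { intros x y Hx Hy. now apply (ex_series_plus x y). }
  destruct h as [p q].
  apply injective_projections; simpl.
  - rewrite (Series_ext _ (fun k => (fst (u k) + (- 1) * fst (v k))
        + ((- p) * fst (w k) + q * snd (w k)))) by (intros k; simpl; ring).
    rewrite !Series_plus, !Series_scal_l by auto. ring.
  - rewrite (Series_ext _ (fun k => (snd (u k) + (- 1) * snd (v k))
        + ((- p) * snd (w k) + (- q) * fst (w k)))) by (intros k; simpl; ring).
    rewrite !Series_plus, !Series_scal_l by auto. ring.
Qed.

(** * Entire functions given by power series *)

Definition dpow (n : nat) (z : C) : C := (INR n * z ^ pred n)%C.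

(** The coefficient of [h ^ i] in [(z + h) ^ n - z ^ n - n h z ^ (n - 1)] is
    [binomial(n, i) z ^ (n - i)] with [i >= 2], so for [|h| <= 1] one can
    extract [|h| ^ 2] and put [h = 1] in what remains. *)
Lemma Cmod_pow_remainder_binomial (z h : C) (n : nat) :
  Cmod h <= 1 ->
  Cmod ((z + h) ^ n - z ^ n - h * dpow n z)%C
  <= Cmod h ^ 2 * ((Cmod z + 1) ^ n - Cmod z ^ n - INR n * Cmod z ^ pred n).
Proof.
  intros Hh. unfold dpow. induction n as [|n IH].
  - simpl.
    replace (1 - 1 - h * (0 * 1))%C with (RtoC 0) by ring.
    rewrite Cmod_0. lra.
  - set (Rn := ((z + h) ^ n - z ^ n - h * (INR n * z ^ pred n))%C) in *.
    set (Bn := (Cmod z + 1) ^ n - Cmod z ^ n - INR n * Cmod z ^ pred n) in *.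
    (* At [n = 0], where [pred n] is not [n - 1], both sides vanish. *)
    assert (EC : (INR n * z ^ n = z * (INR n * z ^ pred n))%C).
    { destruct n as [|m]; [simpl; ring |]. cbn [pred]. rewrite Cpow_S. ring. }
    assert (ER : INR n * Cmod z ^ n = Cmod z * (INR n * Cmod z ^ pred n)).
    { destruct n as [|m]; [simpl; ring |]. cbn [pred pow]. ring. }
    cbn [pred]. rewrite S_INR, RtoC_plus.
    replace ((z + h) ^ S n - z ^ S n - h * ((INR n + 1) * z ^ n))%C
      with ((z + h) * Rn + h * h * (INR n * z ^ pred n))%C.
    2: { unfold Rn. rewrite !Cpow_S.
         replace ((INR n + 1) * z ^ n)%C
           with (INR n * z ^ n + z ^ n)%C by ring.
         rewrite EC. ring. }
    replace ((Cmod z + 1) ^ S n - Cmod z ^ S n - (INR n + 1) * Cmod z ^ n)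
      with ((Cmod z + 1) * Bn + INR n * Cmod z ^ pred n).
    2: { unfold Bn. cbn [pow].
         replace ((INR n + 1) * Cmod z ^ n)
           with (INR n * Cmod z ^ n + Cmod z ^ n) by ring.
         rewrite ER. ring. }
    eapply Rle_trans; [apply Cmod_triangle |].
    rewrite !Cmod_mult, Cmod_pow, Cmod_R, (Rabs_pos_eq (INR n)) by apply pos_INR.
    assert (T : Cmod (z + h) <= Cmod z + 1).
    { eapply Rle_trans; [apply Cmod_triangle | lra]. }
    pose proof (Cmod_ge_0 Rn). pose proof (Cmod_ge_0 (z + h)%C).
    assert (Cmod (z + h) * Cmod Rn <= (Cmod z + 1) * (Cmod h ^ 2 * Bn))
      by (apply Rmult_le_compat; auto).
    simpl in *. lra.
Qed.

Lemma Cmod_dpow (n : nat) (z : C) :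
  Cmod (dpow n z) = INR n * Cmod z ^ pred n.
Proof.
  unfold dpow. rewrite Cmod_mult, Cmod_pow, Cmod_R.
  now rewrite (Rabs_pos_eq (INR n)) by apply pos_INR.
Qed.

Lemma Cmod_dpow_le (n : nat) (z : C) : Cmod (dpow n z) <= (Cmod z + 1) ^ n.
Proof.
  rewrite Cmod_dpow.
  (* The right-hand side of the bound is nonnegative, as [h = 1] shows. *)
  pose proof (Cmod_pow_remainder_binomial z 1 n) as H.
  rewrite Cmod_1 in H. specialize (H (Rle_refl 1)).
  pose proof (Cmod_ge_0 ((z + 1) ^ n - z ^ n - 1 * dpow n z)%C).
  pose proof (pow_le (Cmod z) n (Cmod_ge_0 z)). lra.
Qed.

Lemma Cmod_pow_remainder_le (z h : C) (n : nat) :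
  Cmod h <= 1 ->
  Cmod ((z + h) ^ n - z ^ n - h * dpow n z)%C
  <= Cmod h ^ 2 * (Cmod z + 1) ^ n.
Proof.
  intros Hh. eapply Rle_trans; [now apply Cmod_pow_remainder_binomial |].
  apply Rmult_le_compat_l; [apply pow2_ge_0 |].
  rewrite <- Cmod_dpow.
  pose proof (pow_le (Cmod z) n (Cmod_ge_0 z)).
  pose proof (Cmod_ge_0 (dpow n z)). lra.
Qed.

(** A power series listed by the monomials that occur in it, so that its
    [k]-th term can be tied to a [k]-th point. *)
Definition monomial_series (a : nat -> R) (n : nat -> nat) (z : C) : C :=
  Csum (fun k => a k * z ^ n k)%C.

Section MonomialSeries.

Variables (a : nat -> R) (n : nat -> nat).
Hypothesis a_ge0 : forall k, 0 <= a k.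
Hypothesis a_cv : forall r, 0 <= r -> ex_series (fun k => a k * r ^ n k).

Lemma Cmod_coef_mult (k : nat) (x : C) : Cmod (a k * x)%C = a k * Cmod x.
Proof. now rewrite Cmod_mult, Cmod_R, Rabs_pos_eq. Qed.

Lemma monomial_series_le (z : C) :
  Cmod (monomial_series a n z) <= 2 * Series (fun k => a k * Cmod z ^ n k).
Proof.
  apply Cmod_Csum_le; [| apply a_cv, Cmod_ge_0].
  intros k. rewrite Cmod_coef_mult, Cmod_pow. apply Rle_refl.
Qed.

(** On the positive half-line all terms are nonnegative, so none can cancel. *)
Lemma monomial_series_term_le (t : R) (k : nat) :
  0 <= t -> a k * t ^ n k <= Cmod (monomial_series a n t).
Proof.
  intros Ht.
  set (x := fun k => a k * t ^ n k).
  assert (Hx : forall k, 0 <= x k).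
  { intros j. apply Rmult_le_pos; [apply a_ge0 | now apply pow_le]. }
  apply Rle_trans with (Series x).
  - apply Rle_trans with (sum_n x k).
    + destruct k as [|k]; [rewrite sum_O; apply Rle_refl |].
      rewrite sum_Sn. change (x (S k) <= sum_n x k + x (S k)).
      assert (0 <= sum_n x k); [| lra].
      rewrite sum_n_Reals. now apply cond_pos_sum.
    + apply (is_lim_seq_incr_compare (sum_n x) (Series x)).
      * apply (Series_correct x), a_cv, Ht.
      * intros j. rewrite sum_Sn.
        change (sum_n x j <= sum_n x j + x (S j)). specialize (Hx (S j)). lra.
  - eapply Rle_trans; [| apply re_le_Cmod].
    eapply Rle_trans; [| apply Rle_abs].
    apply Req_le, Series_ext. intros j.
    unfold x. rewrite <- RtoC_pow. simpl. ring.
Qed.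

(** Term by term, the difference between the increment and its linear part is
    at most [|h| ^ 2] times the term of the same series at [|z| + 1]; so the sum
    of the derivatives is the derivative of the sum. *)
Lemma monomial_series_entire : entire (monomial_series a n).
Proof.
  intros z.
  set (r := Cmod z + 1). pose proof (Cmod_ge_0 z) as Hz.
  assert (Hr : 0 <= r) by (unfold r; lra).
  set (total := Series (fun k => a k * r ^ n k)).
  assert (Htotal : 0 <= total).
  { pose proof (monomial_series_term_le r 0 Hr).
    pose proof (Cmod_ge_0 (monomial_series a n r)).
    pose proof (monomial_series_le r) as Htotal.
    rewrite Cmod_R, (Rabs_pos_eq r Hr) in Htotal. fold total in Htotal. lra. }
  exists (Csum (fun k => a k * dpow (n k) z)%C).
  split; [apply is_linear_scal_l |].
  intros x Hx eps.
  assert (Ex : z = x).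
  { exact (@is_filter_lim_locally_unique C_AbsRing
             (AbsRing_NormedModule C_AbsRing) z x Hx). }
  rewrite <- Ex. clear x Hx Ex.
  assert (Hd : 0 < Rmin 1 (eps / (2 * total + 1))).
  { apply Rmin_pos; [lra |]. apply Rdiv_lt_0_compat; [apply cond_pos | lra]. }
  exists (mkposreal _ Hd). intros y Hy. change C in (type of y).
  change (Cmod (y - z)%C < Rmin 1 (eps / (2 * total + 1))) in Hy.
  change (Cmod (monomial_series a n y - monomial_series a n z
           - (y - z) * Csum (fun k => a k * dpow (n k) z))%C
          <= eps * Cmod (y - z)%C).
  assert (H1 : Cmod (y - z)%C <= 1).
  { left. eapply Rlt_le_trans; [exact Hy | apply Rmin_l]. }
  assert (H2 : Cmod (y - z)%C * (2 * total + 1) <= eps).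
  { assert (Hlt : Cmod (y - z)%C < eps / (2 * total + 1))
      by (eapply Rlt_le_trans; [exact Hy | apply Rmin_r]).
    left. apply Rlt_div_r; lra. }
  set (h := (y - z)%C) in *.
  assert (Ey : y = (z + h)%C) by (unfold h; ring).
  assert (Hsum : forall x : C, abs_summable (fun k => a k * x ^ n k)%C).
  { intros x. apply abs_summable_le with (2 := a_cv (Cmod x) (Cmod_ge_0 x)).
    intros k. rewrite Cmod_coef_mult, Cmod_pow. apply Rle_refl. }
  unfold monomial_series. rewrite <- Csum_remainder; auto.
  2: { apply abs_summable_le with (2 := a_cv r Hr). intros k.
       rewrite Cmod_coef_mult.
       apply Rmult_le_compat_l; [apply a_ge0 | apply Cmod_dpow_le]. }
  eapply Rle_trans.
  { apply (Cmod_Csum_le _ (fun k => Cmod h ^ 2 * (a k * r ^ n k))).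
    - intros k. rewrite Ey.
      replace (a k * (z + h) ^ n k - a k * z ^ n k - h * (a k * dpow (n k) z))%C
        with (a k * ((z + h) ^ n k - z ^ n k - h * dpow (n k) z))%C by ring.
      rewrite Cmod_coef_mult.
      replace (Cmod h ^ 2 * (a k * r ^ n k))
        with (a k * (Cmod h ^ 2 * r ^ n k)) by ring.
      apply Rmult_le_compat_l; [apply a_ge0 | now apply Cmod_pow_remainder_le].
    - apply (ex_series_scal (Cmod h ^ 2) (fun k => a k * r ^ n k)), a_cv, Hr. }
  rewrite Series_scal_l. fold total.
  pose proof (Cmod_ge_0 h). simpl. nra.
Qed.

End MonomialSeries.

(** * Weights without a multiplicative space *)

(** The common ground of the two kinds of weights. *)
Record rapid (v : R -> R) : Prop := {
  rapid_pos : forall t, 0 <= t -> 0 < v t;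
  rapid_bound : forall k : nat, exists B, forall t, 0 <= t -> t ^ k * v t <= B
}.

Lemma Hinf_iff_bounded (v : R -> R) (f : C -> C) :
  Hinf v f <->
  entire f /\ exists B, forall z, Cmod (f z) * v (Cmod z) <= B.
Proof.
  unfold Hinf, weighted_norm.
  set (E := fun x => exists z : C, x = Cmod (f z) * v (Cmod z)).
  pose proof (Lub_Rbar_correct E) as [Hub Hlub].
  split; intros [Hf HB]; split; auto.
  - destruct (Lub_Rbar E) as [B| |]; [| easy |].
    + exists B. intros z. apply (Hub (Cmod (f z) * v (Cmod z))). now exists z.
    + destruct (Hub (Cmod (f 0) * v (Cmod 0))). now exists (RtoC 0).
  - destruct HB as [B HB].
    apply Rbar_le_lt_trans with (Finite B); [| easy].
    apply Hlub. intros x [z ->]. apply HB.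
Qed.

(** For [n] large the function [s ^ n * v s] is, up to the factor 2, maximal
    only at points where [v] is small: its value at [2 * T] exceeds its values at
    [s <= T] by the factor [2 ^ n], up to constants that depend on [T] alone. *)
Lemma rapid_near_maximum (v : R -> R) (eps : R) :
  rapid v -> 0 < eps ->
  exists (n : nat) (m t : R),
    0 < m /\ (forall s, 0 <= s -> s ^ n * v s <= m) /\
    0 <= t /\ m <= 2 * (t ^ n * v t) /\ v t <= eps.
Proof.
  intros [Hpos Hbd] Heps.
  destruct (Hbd 0%nat) as [B0 HB0]. destruct (Hbd 1%nat) as [B1 HB1].
  assert (HB1pos : 0 < B1).
  { specialize (HB1 1 Rle_0_1). specialize (Hpos 1 Rle_0_1). lra. }
  (* Since [t * v t <= B1], one has [v t <= eps] for all [t >= T]. *)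
  set (T := B1 / eps).
  assert (HT : 0 < T) by (apply Rdiv_lt_0_compat; lra).
  assert (Hv2T : 0 < v (2 * T)) by (apply Hpos; lra).
  destruct (Pow_x_infinity 2 ltac:(rewrite Rabs_pos_eq; lra)
              (2 * B0 / v (2 * T) + 1)) as [n Hn].
  specialize (Hn n (Nat.le_refl n)).
  rewrite Rabs_pos_eq in Hn by (apply pow_le; lra).
  assert (Hn' : 2 * B0 < 2 ^ n * v (2 * T)).
  { apply Rlt_div_l; lra. }
  set (E := fun x => exists s, 0 <= s /\ x = s ^ n * v s).
  destruct (completeness E) as [m [Hub Hlub]].
  { destruct (Hbd n) as [B HB]. exists B. intros x [s [Hs ->]]. now apply HB. }
  { exists (0 ^ n * v 0), 0. split; [lra | easy]. }
  assert (Hle : forall s, 0 <= s -> s ^ n * v s <= m).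
  { intros s Hs. apply Hub. now exists s. }
  assert (Hm : 0 < m).
  { specialize (Hle (2 * T) ltac:(lra)).
    eapply Rlt_le_trans; [| exact Hle].
    apply Rmult_lt_0_compat; [apply pow_lt; lra | easy]. }
  assert (Hex : exists t, 0 <= t /\ m / 2 < t ^ n * v t).
  { apply NNPP. intros Hno.
    assert (m <= m / 2); [| lra].
    apply Hlub. intros x [s [Hs ->]]. apply Rnot_lt_le. intros Hlt.
    apply Hno. now exists s. }
  destruct Hex as [t [Ht Htm]].
  exists n, m, t. repeat split; auto; [lra |].
  destruct (Rle_lt_dec t T) as [HtT | HTt].
  - exfalso.
    assert (Hp : 0 < T ^ n) by now apply pow_lt.
    assert (H1 : t ^ n * v t <= T ^ n * B0).
    { apply Rmult_le_compat.
      - now apply pow_le.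
      - now apply Rlt_le, Hpos.
      - now apply pow_incr.
      - specialize (HB0 t Ht). simpl in HB0. lra. }
    specialize (Hle (2 * T) ltac:(lra)). rewrite Rpow_mult_distr in Hle.
    assert (T ^ n * (2 * B0) < T ^ n * (2 ^ n * v (2 * T)))
      by now apply Rmult_lt_compat_l.
    lra.
  - specialize (HB1 t Ht). rewrite pow_1 in HB1.
    pose proof (Hpos t Ht).
    assert (E1 : T * eps = B1) by (unfold T; field; lra).
    apply Rmult_le_reg_l with T; [easy |]. nra.
Qed.

(** Squaring turns the lower bound [2 ^ (- k) / (2 * v (t k))] for the series at
    [t k] into one of order [1 / v (t k) ^ 2], and [v (t k) <= 16 ^ (- k)]
    outweighs the loss of [4 ^ (- k)]. *)
Lemma rapid_not_mult_closed (v : R -> R) :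
  rapid v -> ~ mult_closed (Hinf v).
Proof.
  intros Hv Hclosed.
  assert (Hchoice : forall k : nat, exists p : nat * R * R,
    let '(n, a, t) := p in
    0 <= a /\ (forall s, 0 <= s -> a * s ^ n * v s <= (1 / 2) ^ k) /\
    0 <= t /\ (1 / 2) ^ k <= 2 * (a * t ^ n * v t) /\ v t <= (1 / 16) ^ k).
  { intros k.
    assert (Hk : 0 < (1 / 2) ^ k) by (apply pow_lt; lra).
    destruct (rapid_near_maximum v ((1 / 16) ^ k) Hv) as
      (n & m & t & Hm & Hle & Ht & Hmt & Hvt); [apply pow_lt; lra |].
    exists (n, (1 / 2) ^ k / m, t).
    assert (Ha : 0 < (1 / 2) ^ k / m) by now apply Rdiv_lt_0_compat.
    assert (Em : (1 / 2) ^ k = (1 / 2) ^ k / m * m) by (field; lra).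
    repeat split; auto; [lra | |].
    - intros s Hs. rewrite Em at 2. rewrite Rmult_assoc.
      apply Rmult_le_compat_l; [lra | now apply Hle].
    - rewrite Em at 1.
      replace (2 * ((1 / 2) ^ k / m * t ^ n * v t))
        with ((1 / 2) ^ k / m * (2 * (t ^ n * v t))) by ring.
      apply Rmult_le_compat_l; lra. }
  apply functional_choice in Hchoice. destruct Hchoice as [p Hp].
  set (n := fun k => fst (fst (p k))).
  set (a := fun k => snd (fst (p k))).
  set (t := fun k => snd (p k)).
  assert (Hp' : forall k, 0 <= a k /\
    (forall s, 0 <= s -> a k * s ^ n k * v s <= (1 / 2) ^ k) /\
    0 <= t k /\ (1 / 2) ^ k <= 2 * (a k * t k ^ n k * v (t k)) /\
    v (t k) <= (1 / 16) ^ k).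
  { intros k. specialize (Hp k). unfold n, a, t.
    destruct (p k) as [[? ?] ?]. exact Hp. }
  clearbody n a t. clear p Hp.
  assert (Ha : forall k, 0 <= a k) by (intros k; apply Hp').
  assert (Hgeom : is_series (fun k => (1 / 2) ^ k) 2).
  { assert (Hg : is_series (fun k => (1 / 2) ^ k) (/ (1 - 1 / 2))).
    { apply is_series_geom. rewrite Rabs_pos_eq; lra. }
    now replace (/ (1 - 1 / 2)) with 2 in Hg by field. }
  assert (Hdom : forall r, 0 <= r ->
    forall k, 0 <= a k * r ^ n k <= / v r * (1 / 2) ^ k).
  { intros r Hr k. split.
    - apply Rmult_le_pos; [apply Ha | now apply pow_le].
    - destruct (Hp' k) as (_ & Hle & _). specialize (Hle r Hr).
      pose proof (rapid_pos v Hv r Hr) as Hvr.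
      apply Rmult_le_reg_r with (v r); [easy |].
      replace (/ v r * (1 / 2) ^ k * v r) with ((1 / 2) ^ k) by (field; lra).
      exact Hle. }
  assert (Hscaled : forall c, ex_series (fun k => c * (1 / 2) ^ k)).
  { intros c. apply (ex_series_scal c (fun k => (1 / 2) ^ k)). now exists 2. }
  assert (Hcv : forall r, 0 <= r -> ex_series (fun k => a k * r ^ n k)).
  { intros r Hr.
    apply (ex_series_le (V := R_CompleteNormedModule)) with (2 := Hscaled (/ v r)).
    intros k. destruct (Hdom r Hr k).
    change (Rabs (a k * r ^ n k) <= / v r * (1 / 2) ^ k).
    now rewrite Rabs_pos_eq. }
  assert (Hf : Hinf v (monomial_series a n)).
  { apply Hinf_iff_bounded. split; [now apply monomial_series_entire |].
    exists 4. intros z.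
    set (r := Cmod z). assert (Hr : 0 <= r) by apply Cmod_ge_0.
    pose proof (rapid_pos v Hv r Hr) as Hvr.
    apply Rle_trans with (2 * (/ v r * 2) * v r).
    2: { apply Req_le. field. lra. }
    apply Rmult_le_compat_r; [lra |].
    eapply Rle_trans; [now apply monomial_series_le |].
    apply Rmult_le_compat_l; [lra |].
    rewrite <- (is_series_unique _ _ Hgeom), <- Series_scal_l.
    apply Series_le; [now apply Hdom | apply Hscaled]. }
  pose proof (Hclosed _ _ Hf Hf) as Hff.
  apply Hinf_iff_bounded in Hff. destruct Hff as [_ [B HB]].
  destruct (Pow_x_infinity 4 ltac:(rewrite Rabs_pos_eq; lra) (4 * B + 1))
    as [k Hk].
  specialize (Hk k (Nat.le_refl k)).
  rewrite Rabs_pos_eq in Hk by (apply pow_le; lra).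
  destruct (Hp' k) as (_ & _ & Ht & Hlow & Hsmall).
  specialize (HB (t k)).
  rewrite Cmod_mult, Cmod_R, (Rabs_pos_eq (t k) Ht) in HB.
  pose proof (monomial_series_term_le a n Ha Hcv (t k) k Ht) as Hterm.
  pose proof (rapid_pos v Hv (t k) Ht) as Hvt.
  set (F := Cmod (monomial_series a n (t k))) in *. set (w := v (t k)) in *.
  assert (HFw : (1 / 2) ^ k <= 2 * (F * w)).
  { eapply Rle_trans; [exact Hlow |]. apply Rmult_le_compat_l; [lra |].
    apply Rmult_le_compat_r; lra. }
  assert (Hhalf : 0 < (1 / 2) ^ k) by (apply pow_lt; lra).
  (* [4 ^ (- k) <= 4 (F w) ^ 2 <= 4 B w <= 4 B 16 ^ (- k)] *)
  assert (Hsq : (1 / 2) ^ k * (1 / 2) ^ k <= 4 * B * w).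
  { apply Rle_trans with ((2 * (F * w)) * (2 * (F * w))).
    - apply Rmult_le_compat; lra.
    - replace (2 * (F * w) * (2 * (F * w))) with (4 * (F * F * w) * w) by ring.
      apply Rmult_le_compat_r; lra. }
  assert (HBpos : 0 < B) by nra.
  assert (E1 : (1 / 2) ^ k * (1 / 2) ^ k = 4 ^ k * (1 / 16) ^ k).
  { rewrite <- !Rpow_mult_distr. f_equal. lra. }
  assert (H16 : 0 < (1 / 16) ^ k) by (apply pow_lt; lra).
  assert (4 * B * w <= 4 * B * (1 / 16) ^ k)
    by (apply Rmult_le_compat_l; lra).
  assert (4 ^ k <= 4 * B) by (apply Rmult_le_reg_r with ((1 / 16) ^ k); lra).
  lra.
Qed.

Lemma weight_rapid (u : R -> R) : weight u -> rapid u.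
Proof.
  intros [_ Hmono Hpos Hlim]. split; [exact Hpos |]. intros k.
  specialize (Hlim k). apply is_lim_spec in Hlim.
  destruct (Hlim (mkposreal 1 Rlt_0_1)) as [T HT]. simpl in HT.
  set (T' := Rmax T 0).
  assert (HT' : 0 <= T') by apply Rmax_r.
  exists (1 + T' ^ k * u 0). intros t Ht.
  assert (0 <= T' ^ k * u 0).
  { apply Rmult_le_pos; [now apply pow_le |]. apply Rlt_le, Hpos, Rle_refl. }
  destruct (Rle_lt_dec t T') as [Hle | Hlt].
  - assert (t ^ k * u t <= T' ^ k * u 0); [| lra].
    apply Rmult_le_compat.
    + now apply pow_le.
    + now apply Rlt_le, Hpos.
    + now apply pow_incr.
    + apply Hmono; lra.
  - assert (HTt : T < t) by (eapply Rle_lt_trans; [apply Rmax_l | exact Hlt]).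
    specialize (HT t HTt). apply Rabs_def2 in HT. lra.
Qed.

(** The supremum is finite because [M j >= t ^ j] for large [j], which is what
    the divergence of [M j ^ (1 / j)] says. *)
Lemma ln_le_omega (M : nat -> R) (t : R) (j : nat) :
  LC M -> 0 < t -> ln (t ^ j / M j) <= omega M t.
Proof.
  intros HM Ht. unfold omega. destruct (Rlt_dec 0 t) as [_ | []]; [| easy].
  set (x := fun j => ln (t ^ j / M j)).
  assert (Hfin : exists B, forall j, x j <= B).
  { pose proof (LC_root M HM) as Hroot. apply is_lim_seq_spec in Hroot.
    destruct (Hroot t) as [N HN].
    assert (Htail : forall j, (S N <= j)%nat -> x j <= 0).
    { intros i Hi. unfold x. rewrite <- ln_1.
      pose proof (LC_pos M HM i) as HMi.
      apply ln_le.
      - apply Rdiv_lt_0_compat; [now apply pow_lt | easy].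
      - apply Rle_div_l; [easy |]. rewrite Rmult_1_l.
        assert (HNi : t < Rpower (M i) (/ INR i)) by (apply HN; lia).
        assert (Hi0 : INR i <> 0) by (apply not_0_INR; lia).
        replace (M i) with (Rpower (M i) (/ INR i) ^ i).
        + apply pow_incr. lra.
        + rewrite <- Rpower_pow by apply exp_pos.
          rewrite Rpower_mult, Rinv_l, Rpower_1; auto. }
    assert (Hhead : forall N, exists B, forall j, (j <= N)%nat -> x j <= B).
    { intros K. induction K as [|K [B HB]].
      - exists (x 0%nat). intros i Hi.
        replace i with 0%nat by lia. apply Rle_refl.
      - exists (Rmax B (x (S K))). intros i Hi.
        destruct (Nat.eq_dec i (S K)) as [-> | Hne]; [apply Rmax_r |].
        eapply Rle_trans; [apply HB; lia | apply Rmax_l]. }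
    destruct (Hhead N) as [B HB]. exists (Rmax B 0). intros i.
    destruct (Nat.le_gt_cases i N) as [Hi | Hi].
    - eapply Rle_trans; [now apply HB | apply Rmax_l].
    - eapply Rle_trans; [now apply Htail | apply Rmax_r]. }
  destruct Hfin as [B HB].
  pose proof (Sup_seq_correct (fun j => Finite (x j))) as Hsup.
  change (x j <= real (Sup_seq (fun j => Finite (x j)))).
  destruct (Sup_seq (fun j => Finite (x j))) as [l | |]; simpl in *.
  - apply Rnot_lt_le. intros Hlt.
    assert (Heps : 0 < x j - l) by lra.
    destruct (Hsup (mkposreal _ Heps)) as [Hub _].
    specialize (Hub j). simpl in Hub. lra.
  - destruct (Hsup B) as [i Hi]. specialize (HB i). lra.
  - specialize (Hsup (x j) j). lra.
Qed.

Lemma weight_of_seq_rapid (M : nat -> R) : LC M -> rapid (weight_of_seq M).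
Proof.
  intros HM. split; [intros t _; apply exp_pos |].
  intros k. exists (Rmax (M k) (0 ^ k * weight_of_seq M 0)). intros t [Ht | <-].
  2: apply Rmax_r.
  eapply Rle_trans; [| apply Rmax_l].
  pose proof (LC_pos M HM k) as HMk.
  assert (Hq : 0 < t ^ k / M k)
    by (apply Rdiv_lt_0_compat; [now apply pow_lt | easy]).
  pose proof (ln_le_omega M t k HM Ht) as Hln.
  assert (He : t ^ k / M k <= exp (omega M t)).
  { rewrite <- (exp_ln _ Hq). destruct Hln as [Hlt | ->].
    - left. now apply exp_increasing.
    - apply Rle_refl. }
  unfold weight_of_seq. rewrite exp_Ropp.
  pose proof (exp_pos (omega M t)).
  apply Rle_div_l; [easy |].
  apply Rle_div_l in He; [| easy]. lra.
Qed.

Theorem corollary4p14 :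
  (forall M : nat -> R, LC M -> ~ mult_closed (Hinf (weight_of_seq M))) /\
  (forall u : R -> R, weight u -> normalized u -> ~ mult_closed (Hinf u)).
Proof.
  split.
  - intros M HM. now apply rapid_not_mult_closed, weight_of_seq_rapid.
  - intros u Hu _. now apply rapid_not_mult_closed, weight_rapid.
Qed.
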